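(* Fix $\mathsf T\ge100$, $\mathsf b\in(0,1)$, $\eta_*\in(0,1/4)$, and let $\mu_0=\frac1n\sum_{i=1}^n\delta_{\lambda_i(0)}$ be supported on $(-\infty,0]$ with $\mu_0([-x,0])\ge\mathsf b x^{3/2}$ for all $\eta_*\le x\le\mathsf T^2$. Let $\mathfrak C=2^{21}/\mathsf b^2$ and $\mathfrak c=\mathsf b\,\mathfrak C^{-3/2}$, assume $\mathfrak C^2\eta_*\ge(\log n)^{15}/n^{2/3}$, and define $$f(t)=\max\Big\{\mathfrak C\sqrt{\eta_*}-\tfrac{\mathfrak c}{8}\max\{0,t-\mathfrak C\sqrt{\eta_*}\},\ (\log n)^{15/2}n^{-1/3}\Big\}^2 .$$ Fix real numbers $0<t\le\mathsf T$ and $0\le s\le t$, take $u\in\Lambda_t$, and write $z_r=z_r(u)=E_r+\kappa_r+\mathrm i\eta_r$ for $0\le r\le t$. Assume that $\kappa_s\le\mathsf T^2$. If $\kappa_t\ge f(t)$ and $\mathfrak C\sqrt{\eta_*}\le s\le t$, then $$\kappa_s-f(s)\ge\frac{t-s}{2}\,\operatorname{Im}[m_t(z_t)]\,\frac{\kappa_t}{\eta_t} .$$ Moreover, if $\kappa_t\ge f(t)$ and $0\le s\le\widetilde t:=\min\{t,\mathfrak C\sqrt{\eta_*}\}$, then $$\kappa_s-f(s)\ge(\widetilde t-s)\,\operatorname{Im}[m_t(z_t)]\,\frac{\kappa_{\widetilde t}}{\eta_{\widetilde t}} .$$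
   Context: $m_0(z)=\int\frac{\mu_0(dx)}{x-z}$ for $z\in\mathbb H$ (upper half-plane). $\Lambda_t=\{z\in\mathbb H:\int\frac{\mu_0(dx)}{|z-x|^2}<\frac1t\}$ for $t>0$ and $\Lambda_0=\mathbb H$. $\mu_t=\mu_0\boxplus\mu_{\rm sc}^{(t)}$ is the free convolution of $\mu_0$ with the semicircle distribution $\frac{\sqrt{4t-x^2}}{2\pi t}\mathbf 1_{|x|\le2\sqrt t}dx$; its Stieltjes transform $m_t$ is determined by $m_t(z-tm_0(z))=m_0(z)$ for $z\in\Lambda_t$ (the map $z\mapsto z-tm_0(z)$ is a bijection $\Lambda_t\to\mathbb H$). $E_t=\max(\operatorname{supp}\mu_t)$. **Characteristic flow.** For $u\in\Lambda_t$ and $0\le r\le t$ (so $u\in\Lambda_r$), $z_r(u)=u-r\,m_0(u)$, and $\kappa_r=\operatorname{Re}z_r(u)-E_r$, $\eta_r=\operatorname{Im}z_r(u)$. *)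

(* Defs.v *)
From HB Require Import structures.
From mathcomp Require Import all_boot all_order all_algebra.
From mathcomp Require Import complex.
From mathcomp Require Import all_classical all_reals all_analysis.

Set Implicit Arguments.
Unset Strict Implicit.
Unset Printing Implicit Defensive.

Import Order.TTheory GRing.Theory Num.Theory.
Import numFieldNormedType.Exports.

Local Open Scope classical_set_scope.
Local Open Scope ring_scope.
Local Open Scope complex_scope.

Section defs.
Context {R : realType}.
Implicit Types mu nu : probability (measurableTypeR R) R.

Definition empirical_law (n : nat) (lambda : 'I_n -> R) mu : Prop :=
  forall A : set (measurableTypeR R), measurable A ->
    mu A = ((n%:R^-1)%:E * \sum_(i < n) \d_(lambda i : measurableTypeR R) A)%E.

Definition supp mu : set R :=
  [set x : R | forall U : set R, open U -> U x -> (0 < mu U)%E].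

(* The maximum of [supp mu]; it is 0 by default if there is none, which does
   not happen for a compactly supported [mu]. *)
Definition right_edge mu : R := xget 0 (supp mu `&` ubound (supp mu)).

Definition upper_half_plane : set R[i] := [set z | 0 < complex.Im z].

(* The complex integral of 1 / (x - z), taken componentwise. *)
Definition stieltjes mu (z : R[i]) : R[i] :=
  (\int[mu]_x complex.Re ((x%:C - z)^-1)) +i*
  (\int[mu]_x complex.Im ((x%:C - z)^-1)).

(* The case t = 0 is separate because 0^-1 = 0 in [R]. *)
Definition Lambda mu (t : R) : set R[i] :=
  if t == 0 then upper_half_plane
  else [set z | upper_half_plane z /\
         (\int[mu]_x ((Normc.normc (z - x%:C) ^+ 2)^-1)%:E < (t^-1)%:E)%E].

Definition char_flow mu (t : R) (z : R[i]) : R[i] :=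
  z - t%:C * stieltjes mu z.

(* [nu] is the free convolution of [mu] with the semicircle distribution of
   variance [t].  As z |-> z - t m_mu(z) maps [Lambda mu t] onto the upper
   half-plane, this equation prescribes the Stieltjes transform of [nu] on the
   whole upper half-plane, hence determines [nu]. *)
Definition is_free_conv_sc mu (t : R) nu : Prop :=
  forall z, Lambda mu t z ->
    stieltjes nu (char_flow mu t z) = stieltjes mu z.

Definition bigC (b : R) : R := 2 ^+ 21 / b ^+ 2.

Definition smallc (b : R) : R := b * bigC b `^ (- (3 / 2)).

Definition edge_bound (n : nat) (b etas t : R) : R :=
  Num.max
    (bigC b * Num.sqrt etas
       - smallc b / 8 * Num.max 0 (t - bigC b * Num.sqrt etas))
    (ln n%:R `^ (15 / 2) * n%:R `^ (- (1 / 3))) ^+ 2.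

(* For a family [mu] of laws, the coordinates of z_r(u) = E_r + kappa_r + i eta_r,
   where E_r is the right edge of [mu r] and the flow is driven by [mu 0]. *)
Definition kappa_flow (mu : R -> probability (measurableTypeR R) R)
    (u : R[i]) (r : R) : R :=
  complex.Re (char_flow (mu 0) r u) - right_edge (mu r).

Definition eta_flow (mu : R -> probability (measurableTypeR R) R)
    (u : R[i]) (r : R) : R :=
  complex.Im (char_flow (mu 0) r u).

End defs.

(* Main.v *)
Require Import Defs.
From HB Require Import structures.
From mathcomp Require Import all_boot all_order all_algebra.
From mathcomp Require Import complex.
From mathcomp Require Import all_classical all_reals all_analysis.
From mathcomp Require Import measurable_realfun.
From mathcomp Require Import ring lra.

Import Order.TTheory GRing.Theory Num.Theory.
Import numFieldNormedType.Exports.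

Local Open Scope classical_set_scope.
Local Open Scope ring_scope.
Local Open Scope complex_scope.

(** Write [m] for the Stieltjes transform of the initial law, [G = - m] for its
    resolvent on the real line to the right of the atoms [lambda i], and
    [u = x + i y] for the starting point of the characteristic.

    _The edge._  For [r > 0] let [xi] be the point to the right of all atoms
    where the average of [(xi - lambda i)^-2] equals [1 / r].  Then the right
    edge is [E_r = xi + r G(xi)], which is also the minimum of [v + r G(v)] over
    [v] to the right of the atoms ([edge_map_min], [right_edge_flow]).  That
    nothing lies beyond this point and that it does belong to the support are
    both read off the imaginary part of [m_r(z_r) = m(u)] as [y] tends to [0]:
    beyond it the ratio [Im m_r / Im z_r] stays bounded, so that an interval of
    length [d] has mass [O(d^2)], hence mass [0] ([flow_null]); at it the ratio
    blows up ([preedge_in_supp]).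

    _Convexity._  As a minimum of functions affine in [r], the edge [E_r] is
    concave in [r], whereas [Re z_r] is affine.  So [kappa_r] is convex, and
    [kappa_s >= kappa_r + (r - s) P_r], where [P_r = G(xi) + Re m(u)] is the
    opposite of its slope ([kappa_convex]).  No differential equation is needed.

    _Two lower bounds on the slope._  First,
    [P_r > Im m(u) kappa_r / eta_r] at all times [r] ([slope_gt_ratio]).  Second,
    [P_r >= (b / 8) sqrt kappa_r] as soon as [r] is at least
    [bigC b * sqrt etas] and [0 <= kappa_r <= T^2] ([slope_growth]): for such
    [r] the growth of the initial law pushes [xi] above [etas] and forces
    [sqrt xi >= b r / 4] ([preedge_bounds]).

    _Conclusion._  The second bound makes [sqrt kappa] increase backwards in
    time at speed at least [smallc b / 4] ([sqrt_growth]), twice the speed of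
    the square root of [edge_bound].  Averaging the resulting bound on
    [kappa_s] with the one given by convexity and the first bound gives the
    first claim ([combine_growth]).  Before time [bigC b * sqrt etas] the
    function [edge_bound] is constant and convexity alone suffices. *)

(** * Averages over the atoms *)

Definition avg {R : realType} {n : nat} (F : 'I_n -> R) : R :=
  n%:R^-1 * \sum_(i < n) F i.

Section averages.
Context {R : realType} {n : nat}.
Implicit Types F G : 'I_n -> R.

Lemma avgD F G : avg (fun i => F i + G i) = avg F + avg G.
Proof. by rewrite /avg big_split mulrDr. Qed.

Lemma avgZ c F : avg (fun i => c * F i) = c * avg F.
Proof. by rewrite /avg -mulr_sumr mulrCA. Qed.

Lemma avgB F G : avg (fun i => F i - G i) = avg F - avg G.
Proof. by rewrite /avg sumrB mulrBr. Qed.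

Lemma eq_avg F G : F =1 G -> avg F = avg G.
Proof. by move=> FG; rewrite /avg (eq_bigr G). Qed.

Lemma le_avg F G : (forall i, F i <= G i) -> avg F <= avg G.
Proof.
by move=> FG; rewrite /avg ler_wpM2l ?invr_ge0 ?ler0n// ler_sum.
Qed.

Lemma avg_ge0 F : (forall i, 0 <= F i) -> 0 <= avg F.
Proof.
by move=> F0; rewrite /avg mulr_ge0 ?invr_ge0 ?ler0n// sumr_ge0.
Qed.

Lemma avg_cst (c : R) : (0 < n)%N -> avg (fun _ : 'I_n => c) = c.
Proof.
move=> n0; rewrite /avg sumr_const card_ord -[c *+ n]mulr_natl mulKf//.
by rewrite pnatr_eq0 -lt0n.
Qed.

Lemma le_term_avg F (k : 'I_n) : (forall i, 0 <= F i) -> n%:R^-1 * F k <= avg F.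
Proof.
move=> F0; rewrite /avg ler_wpM2l ?invr_ge0 ?ler0n//.
by rewrite (bigD1 k)//= lerDl sumr_ge0.
Qed.

Lemma avg_gt0 F : (0 < n)%N -> (forall i, 0 < F i) -> 0 < avg F.
Proof.
move=> n0 F0; apply: lt_le_trans (le_term_avg F (Ordinal n0) _).
  by rewrite mulr_gt0 ?invr_gt0 ?ltr0n.
by move=> i; exact: ltW.
Qed.

Lemma cvg_avg (F : R -> 'I_n -> R) x :
  (forall i, F^~ i @ x --> F x i) -> (fun x => avg (F x)) @ x --> avg (F x).
Proof.
move=> Fx; apply: cvgM; first exact: cvg_cst.
apply: (@cvg_big _ _ +%R) => //; exact: add_continuous.
Qed.

End averages.

(** * Resolvents of an empirical law, to the right of its atoms *)

Section resolvent.
Context {R : realType} {n : nat}.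
Variable lambda : 'I_n -> R.
Implicit Types x y r xi : R.

Definition right_of x := forall i, lambda i < x.
(** With [m] the Stieltjes transform of the empirical law of [lambda],
    [green x] is [- m x] and [green2 x] is the derivative [m' x], for real [x]
    off the atoms; at a complex point, [m (x + i y)] is
    [- cgreen x y + i (y * pois x y)].  The condition [r * pois x y < 1] says
    that [x + i y] lies in the domain of the flow at time [r]. *)
Definition green x := avg (fun i => (x - lambda i)^-1).
Definition green2 x := avg (fun i => (x - lambda i) ^- 2).
Definition dist2 x y (i : 'I_n) := (x - lambda i) ^+ 2 + y ^+ 2.
Definition pois x y := avg (fun i => (dist2 x y i)^-1).
Definition cgreen x y := avg (fun i => (x - lambda i) / dist2 x y i).
Definition edge_map r x := x + r * green x.
(** The critical point of [edge_map r] to the right of the atoms; the flow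
    sends it to the right edge at time [r]. *)
Definition preedge r xi := right_of xi /\ r * green2 xi = 1.

Lemma right_ofW {x x'} : right_of x -> x <= x' -> right_of x'.
Proof. by move=> rx xx' i; exact: lt_le_trans (rx i) xx'. Qed.

Lemma dist2_gt0 x y i : 0 < y -> 0 < dist2 x y i.
Proof. by move=> y0; rewrite /dist2 ltr_wpDl ?sqr_ge0 ?exprn_gt0. Qed.

Lemma green_ge0 x : right_of x -> 0 <= green x.
Proof. by move=> rx; apply: avg_ge0 => i; rewrite invr_ge0 subr_ge0 ltW. Qed.

Lemma green2_anti x x' : right_of x -> x <= x' -> green2 x' <= green2 x.
Proof.
move=> rx xx'; apply: le_avg => i.
have := rx i => ri.
rewrite lef_pV2 ?posrE ?exprn_gt0 ?subr_gt0//; last exact: lt_le_trans xx'.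
by rewrite ler_pXn2r ?nnegrE ?subr_ge0 ?lerD2r// ltW// (lt_le_trans ri).
Qed.

Lemma green2_lt x x' : (0 < n)%N -> right_of x -> x < x' -> green2 x' < green2 x.
Proof.
move=> n0 rx xx'; rewrite -subr_gt0 -avgB; apply: avg_gt0 => // i.
have ri := rx i.
rewrite subr_gt0 ltf_pV2 ?posrE ?exprn_gt0 ?subr_gt0//; last exact: lt_trans xx'.
by rewrite ltr_pXn2r ?nnegrE ?subr_ge0 ?ltrD2r// ltW// (lt_trans ri).
Qed.

Lemma pois_le_green2 x y : right_of x -> pois x y <= green2 x.
Proof.
move=> rx; apply: le_avg => i; have ri := rx i.
have h : 0 < (x - lambda i) ^+ 2 by rewrite exprn_gt0 ?subr_gt0.
rewrite lef_pV2 ?posrE ?ltr_wpDr ?sqr_ge0//.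
by rewrite lerDl sqr_ge0.
Qed.

Lemma exists_max : (0 < n)%N -> exists k, forall i, lambda i <= lambda k.
Proof.
move=> n0; exists [arg max_(i > Ordinal n0) lambda i]%O.
by case: Order.TotalTheory.arg_maxP => // k _ h i; exact: h.
Qed.

Lemma edge_map_ge x r : 0 <= r -> right_of x -> x <= edge_map r x.
Proof. by move=> r0 rx; rewrite lerDl mulr_ge0// green_ge0. Qed.

Lemma continuous_green x : right_of x -> {for x, continuous green}.
Proof.
move=> rx; apply: (cvg_avg (fun x i => (x - lambda i)^-1)) => i.
apply: cvgV; last by apply: cvgB => //; exact: cvg_cst.
by rewrite gt_eqF// subr_gt0.
Qed.

Lemma continuous_green2 x : right_of x -> {for x, continuous green2}.
Proof.
move=> rx; apply: (cvg_avg (fun x i => (x - lambda i) ^- 2)) => i.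
apply: cvgV; first by rewrite expf_neq0// gt_eqF// subr_gt0.
by rewrite !expr2; apply: cvgM; apply: cvgB => //; exact: cvg_cst.
Qed.

(** The largest atom has mass at least [1 / n] and no atom is closer, which
    locates the solution between [sqrt (r / n)] and [sqrt r] to the right of it. *)
Lemma preedge_exists r : (0 < n)%N -> 0 < r -> exists xi, preedge r xi.
Proof.
move=> n0 r0; have [k hk] := exists_max n0.
have nr0 : 0 < n%:R :> R by rewrite ltr0n.
have n1 : 1 <= n%:R :> R by rewrite ler1n.
pose a := lambda k + Num.sqrt (r / n%:R); pose b := lambda k + Num.sqrt r.
have sa0 : 0 < Num.sqrt (r / n%:R) by rewrite sqrtr_gt0 divr_gt0.
have sb0 : 0 < Num.sqrt r by rewrite sqrtr_gt0.
have ra : right_of a by move=> i; rewrite /a; have := hk i; lra.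
have ab : a <= b.
  by rewrite /a /b lerD2l ler_wsqrtr// ler_pdivrMr// ler_peMr// ltW.
have ga : r^-1 <= green2 a.
  apply: le_trans (le_term_avg _ k _); last by move=> i; rewrite invr_ge0 sqr_ge0.
  rewrite /a addrAC subrr add0r sqr_sqrtr; last by rewrite divr_ge0// ltW.
  by rewrite invf_div mulKf// gt_eqF.
have gb : green2 b <= r^-1.
  rewrite -[r^-1](avg_cst _ n0); apply: le_avg => i.
  have h : Num.sqrt r <= b - lambda i by rewrite /b; have := hk i; lra.
  rewrite lef_pV2 ?posrE// ?exprn_gt0// ?(lt_le_trans sb0)//.
  rewrite -[leLHS](@sqr_sqrtr _ r) ?(ltW r0)//.
  by rewrite ler_pXn2r ?nnegrE ?(ltW sb0)// ltW// (lt_le_trans sb0).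
have cg : {within `[a, b], continuous green2}.
  apply: continuous_in_subspaceT => x /set_mem; rewrite /= in_itv /=.
  by move=> /andP[ax _]; apply: continuous_green2; exact: right_ofW ax.
have := @IVT R green2 a b r^-1 ab cg.
rewrite ge_min gb orbT le_max ga => /(_ isT)[xi].
rewrite in_itv /= => /andP[axi _] e; exists xi; split.
  exact: right_ofW axi.
by rewrite e mulfV// gt_eqF.
Qed.

(** [edge_map r] is convex to the right of the atoms and [xi] is its critical
    point; the proof factors [(x - xi)^2] out of the difference. *)
Lemma edge_map_min r xi x : 0 <= r -> preedge r xi -> right_of x ->
  edge_map r xi <= edge_map r x.
Proof.
move=> r0 [rxi e] rx; rewrite -subr_ge0.
suff -> : edge_map r x - edge_map r xi = r * avg (fun i =>
    (x - xi) ^+ 2 * ((xi - lambda i) ^- 2 * (x - lambda i)^-1)).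
  apply: mulr_ge0 => //; apply: avg_ge0 => i.
  by rewrite mulr_ge0 ?sqr_ge0// mulr_ge0 ?invr_ge0 ?sqr_ge0// subr_ge0 ltW.
rewrite /edge_map.
have -> : x + r * green x - (xi + r * green xi) =
   (x - xi) * (r * green2 xi) + r * green x - r * green xi.
  by rewrite e; ring.
rewrite -[X in _ = r * X]addr0.
have -> : (x - xi) * (r * green2 xi) + r * green x - r * green xi =
   r * ((x - xi) * green2 xi + green x - green xi) by ring.
rewrite addr0; congr (r * _); rewrite -avgZ -avgD -avgB; apply: eq_avg => i.
have := rx i; have := rxi i => h1 h2; field.
by rewrite !subr_eq0 !gt_eqF.
Qed.

(** Since [edge_map r X >= X], the intermediate value theorem applies on the
    interval from [x] to [X] itself. *)
Lemma edge_map_onto r x X : 0 <= r -> right_of x -> edge_map r x <= X ->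
  exists x0, [/\ x <= x0 & edge_map r x0 = X].
Proof.
move=> r0 rx hX.
have xX : x <= X by apply: le_trans (edge_map_ge _ _ r0 rx) hX.
have rX := right_ofW rx xX.
have cH : {within `[x, X], continuous (edge_map r)}.
  apply: continuous_in_subspaceT => y /set_mem; rewrite /= in_itv /=.
  move=> /andP[xy _]; apply: cvgD => //; apply: cvgM; first exact: cvg_cst.
  by apply: continuous_green; exact: right_ofW xy.
have := @IVT R (edge_map r) x X X xX cH.
rewrite ge_min hX le_max (edge_map_ge _ _ r0 rX) orbT => /(_ isT)[x0].
by rewrite in_itv /= => /andP[h _] <-; exists x0.
Qed.

(** Quantitative forms of the convergence of [cgreen x y] to [green x], and of
    [pois x y] to [green2 x], as [y] tends to [0]. *)
Lemma cgreen_close x y : right_of x ->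
  0 <= green x - cgreen x y <= y ^+ 2 * avg (fun i => (x - lambda i) ^- 3).
Proof.
move=> rx; rewrite -avgB.
have E i : (x - lambda i)^-1 - (x - lambda i) / dist2 x y i =
    y ^+ 2 * ((x - lambda i)^-1 * (dist2 x y i)^-1).
  have h : 0 < x - lambda i by rewrite subr_gt0.
  have d0 : 0 < dist2 x y i by rewrite ltr_wpDr ?sqr_ge0 ?exprn_gt0.
  by move: d0; rewrite /dist2 => d0; field; rewrite !gt_eqF.
rewrite (eq_avg _ _ E) avgZ; apply/andP; split.
  rewrite mulr_ge0 ?sqr_ge0//; apply: avg_ge0 => i.
  have h : 0 < x - lambda i by rewrite subr_gt0.
  by rewrite mulr_ge0// invr_ge0 ?(ltW h)// addr_ge0 ?sqr_ge0.
rewrite ler_wpM2l ?sqr_ge0//; apply: le_avg => i.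
have h : 0 < x - lambda i by rewrite subr_gt0.
rewrite [X in _ <= X^-1]exprS invfM ler_wpM2l ?invr_ge0 ?(ltW h)//.
rewrite lef_pV2 ?posrE ?ltr_wpDr ?sqr_ge0 ?exprn_gt0//.
by rewrite lerDl sqr_ge0.
Qed.

Lemma pois_close x y : right_of x ->
  green2 x - pois x y <= y ^+ 2 * avg (fun i => (x - lambda i) ^- 4).
Proof.
move=> rx; rewrite -avgB -avgZ; apply: le_avg => i.
have h : 0 < x - lambda i by rewrite subr_gt0.
have d0 : 0 < (x - lambda i) ^+ 2 + y ^+ 2 by rewrite ltr_wpDr ?sqr_ge0 ?exprn_gt0.
have -> : (x - lambda i) ^- 2 - (dist2 x y i)^-1 =
    y ^+ 2 * ((x - lambda i) ^- 2 * (dist2 x y i)^-1).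
  by rewrite /dist2; field; rewrite !gt_eqF.
rewrite ler_wpM2l ?sqr_ge0// (_ : 4 = 2 + 2)%N//.
rewrite [X in _ <= X^-1]exprD [X in _ <= X]invfM.
rewrite ler_wpM2l ?invr_ge0 ?sqr_ge0//.
by rewrite lef_pV2 ?posrE ?exprn_gt0// lerDl sqr_ge0.
Qed.

(** For [p = x - xi], this inequality is the strict positivity of
    [Im (w * conj M)], where [w = p + i y] and [M = m (xi + w) - m xi]: the
    difference is the average of [|w|^2 / ((xi - lambda i) * dist2 x y i)]. *)
Lemma slope_gt x y xi : (0 < n)%N -> 0 < y -> right_of xi ->
  (x - xi) * pois x y < green xi - cgreen x y.
Proof.
move=> n0 y0 rxi; rewrite -subr_gt0 -avgZ -!avgB; apply: avg_gt0 => // i.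
have h : 0 < xi - lambda i by rewrite subr_gt0.
have d0 := dist2_gt0 x y i y0.
have -> : (xi - lambda i)^-1 - (x - lambda i) / dist2 x y i -
   (x - xi) * (dist2 x y i)^-1 =
   ((x - xi) ^+ 2 + y ^+ 2) * ((xi - lambda i)^-1 * (dist2 x y i)^-1).
  by move: d0; rewrite /dist2 => d0; field; rewrite !gt_eqF.
by rewrite mulr_gt0 ?mulr_gt0 ?invr_gt0// ltr_wpDl ?sqr_ge0 ?exprn_gt0.
Qed.

(** At fixed real part [x >= xi] the slope is smallest when [y = 0]. *)
Lemma slope_ge x y xi : 0 < y -> right_of xi -> xi <= x ->
  avg (fun i => (x - xi) / ((xi - lambda i) * (x - lambda i)))
  <= green xi - cgreen x y.
Proof.
move=> y0 rxi xix; rewrite -avgB; apply: le_avg => i.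
have h : 0 < xi - lambda i by rewrite subr_gt0.
have h' : 0 < x - lambda i by rewrite (lt_le_trans h)// lerD2r.
have d0 := dist2_gt0 x y i y0; rewrite -subr_ge0.
have -> : (xi - lambda i)^-1 - (x - lambda i) / dist2 x y i -
   (x - xi) / ((xi - lambda i) * (x - lambda i)) =
   y ^+ 2 / ((x - lambda i) * dist2 x y i).
  by move: d0; rewrite /dist2 => d0; field; rewrite !gt_eqF.
by rewrite divr_ge0 ?sqr_ge0// mulr_ge0// ltW.
Qed.

End resolvent.
(** * Growth of the initial law and the size of the slope *)

Section growth.
Context {R : realType} {n : nat}.
Variables (lambda : 'I_n -> R) (b eta T : R).
Hypothesis lambda_le0 : forall i, lambda i <= 0.
Hypothesis b_gt0 : 0 < b.
Hypothesis eta_gt0 : 0 < eta.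
Hypothesis T_ge1 : 1 <= T.
Hypothesis growth : forall v, eta <= v <= T ^+ 2 ->
  b * (v * Num.sqrt v) <= avg (fun i => (- v <= lambda i)%R%:R).

Lemma avg_growth (F : 'I_n -> R) c v : eta <= v <= T ^+ 2 ->
  0 <= c -> (forall i, 0 <= F i) -> (forall i, - v <= lambda i -> c <= F i) ->
  c * (b * (v * Num.sqrt v)) <= avg F.
Proof.
move=> hv c0 F0 cF; apply: le_trans (ler_wpM2l c0 (growth _ hv)) _.
rewrite -avgZ; apply: le_avg => i.
by case: (boolP (- v <= lambda i)) => [/cF|]; rewrite ?mulr1 ?mulr0.
Qed.

(** Atoms in [-v, 0] are at distance at most [2 v] from [xi <= v], and their
    total mass is at least [b * v^(3/2)]. *)
Lemma green2_growth xi v : eta <= v <= T ^+ 2 -> right_of lambda xi -> xi <= v ->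
  b <= 4 * Num.sqrt v * green2 lambda xi.
Proof.
move=> hv rxi xv; have /andP[ev vT] := hv.
have v0 : 0 < v by exact: lt_le_trans ev.
have s0 : 0 < Num.sqrt v by rewrite sqrtr_gt0.
have := avg_growth (fun i => (xi - lambda i) ^- 2) ((2 * v) ^- 2) v hv.
have -> : (2 * v) ^- 2 * (b * (v * Num.sqrt v)) = b / (4 * Num.sqrt v).
  by rewrite -{1 2}[v](@sqr_sqrtr _ v) ?(ltW v0)//; field; rewrite gt_eqF.
move=> h; rewrite mulrC -ler_pdivrMr ?mulr_gt0//.
apply: h => [|i|i vl]; rewrite ?invr_ge0 ?sqr_ge0//.
have h := rxi i; rewrite lef_pV2 ?posrE ?exprn_gt0 ?mulr_gt0 ?subr_gt0//.
by rewrite ler_pXn2r ?nnegrE ?mulr_ge0 ?subr_ge0 ?(ltW h) ?(ltW v0)//; lra.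
Qed.

(** If [xi <= etas], the mass of [-etas, 0] would make [green2 xi] exceed
    [1 / r].  Once [xi > etas], the same estimate at scale [xi] itself bounds
    [r] by [4 * sqrt xi / b].  All the atoms are nonpositive, so
    [green2 xi <= xi^-2] and [xi^2 <= r <= T]. *)
Lemma preedge_bounds r xi : (0 < n)%N -> 0 < r <= T -> preedge lambda r xi ->
  4 * Num.sqrt eta < b * r -> eta < T ^+ 2 ->
  [/\ eta < xi, xi <= T ^+ 2 & b * r <= 4 * Num.sqrt xi].
Proof.
move=> n0 /andP[r0 rT] [rxi e] hr etaT.
have rescale w : 4 * w = r * (4 * w * green2 lambda xi).
  by rewrite mulrCA e mulr1.
have exi : eta < xi.
  rewrite ltNge; apply/negP => xie.
  have hv : eta <= eta <= T ^+ 2 by rewrite lexx ltW.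
  have := green2_growth _ _ hv rxi xie => h.
  have : b * r <= 4 * Num.sqrt eta.
    by rewrite (rescale (Num.sqrt eta)) [leLHS]mulrC ler_wpM2l// ltW.
  by rewrite leNgt hr.
have xi0 : 0 < xi by exact: lt_trans exi.
have xiT : xi <= T ^+ 2.
  have : green2 lambda xi <= xi ^- 2.
    rewrite -[leRHS](avg_cst (n:=n))//; apply: le_avg => i.
    have h := lambda_le0 i.
    have h1 : xi <= xi - lambda i by lra.
    have h2 := lt_le_trans xi0 h1.
    rewrite lef_pV2 ?posrE ?exprn_gt0//.
    by rewrite ler_pXn2r ?nnegrE// ltW.
  rewrite -(ler_pM2l r0) e ler_pdivlMr ?exprn_gt0// mul1r => h.
  rewrite leNgt; apply/negP => hT.
  have T1 : T <= T ^+ 2 by rewrite expr2 ler_peMr// (le_trans _ T_ge1).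
  have : xi <= xi ^+ 2.
    have : 1 <= xi by move: hT T1 T_ge1; lra.
    by rewrite expr2; apply: ler_peMr; exact: ltW.
  lra.
split => //.
have hv : eta <= xi <= T ^+ 2 by rewrite xiT ltW.
have := green2_growth _ _ hv rxi (lexx _) => h.
by rewrite (rescale (Num.sqrt xi)) [leLHS]mulrC ler_wpM2l// ltW.
Qed.

(** Put [p = x - xi], so that [k = p - r P] with [P] the slope, and let [Q] be
    the value of the slope at [y = 0], a lower bound for [P].  If [p < xi], then
    all the distances [xi - lambda i] dominate [p]; thus [Q >= p / (2 r)] and
    [k <= p^2 / xi], and the claim follows from [sqrt xi >= b r / 4].  If
    [p >= xi], the atoms of [-v, 0] with [v = min p T^2] suffice, as [k <= v]. *)
Lemma slope_growth r xi x y
    (k := x - xi - r * (green lambda xi - cgreen lambda x y)) :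
  (0 < n)%N -> 0 < r <= T -> preedge lambda r xi ->
  4 * Num.sqrt eta < b * r -> eta < T ^+ 2 ->
  0 < y -> r * pois lambda x y < 1 -> 0 <= k <= T ^+ 2 ->
  b / 8 * Num.sqrt k <= green lambda xi - cgreen lambda x y.
Proof.
move=> n0 hrT pxi hr etaT y0 hS /andP[k0 kT].
have [exi xiT bxi] := preedge_bounds _ _ n0 hrT pxi hr etaT.
have /andP[r0 rT] := hrT.
have [rxi e] := pxi.
have xi0 : 0 < xi by exact: lt_trans exi.
have := slope_gt lambda x y xi n0 y0 rxi.
move: k0 kT; rewrite /k {k}.
set P := green lambda xi - cgreen lambda x y => k0 kT hP.
set p := x - xi in k0 kT hP *.
have S0 : 0 <= pois lambda x y.
  by apply: avg_ge0 => i; rewrite invr_ge0 ltW// dist2_gt0.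
(* A negative [p] would give [r P > p], as [r * pois x y < 1], hence [k < 0]. *)
have p0 : 0 <= p.
  rewrite leNgt; apply/negP => p0.
  have : p * 1 < p * (r * pois lambda x y) by rewrite ltr_nM2l.
  have : r * (p * pois lambda x y) < r * P by rewrite ltr_pM2l.
  lra.
have P0 : 0 < P by apply: le_lt_trans hP; rewrite mulr_ge0.
have xix : xi <= x by rewrite -subr_ge0.
have := slope_ge lambda x y xi y0 rxi xix.
rewrite -/P -/p; set Q := avg _ => QP.
have rP0 : 0 <= r * P by rewrite mulr_ge0// ltW.
have hY i : xi <= xi - lambda i by have := lambda_le0 i; lra.
have Y0 i : 0 < xi - lambda i by exact: lt_le_trans (hY i).
have x0 i : 0 < x - lambda i by rewrite (lt_le_trans (Y0 i)) ?lerD2r.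
have [pxi'|xip] := ltP p xi.
  have Qr : p / 2 <= r * Q.
    have -> : p / 2 = r * (p / 2 * green2 lambda xi).
      by rewrite mulrCA e mulr1.
    rewrite ler_pM2l// -avgZ; apply: le_avg => i.
    rewrite -mulrA ler_wpM2l// -invfM lef_pV2 ?posrE ?mulr_gt0 ?exprn_gt0//.
    have -> : x - lambda i = (xi - lambda i) + p by rewrite /p; ring.
    have := hY i; have := Y0 i; nra.
  have kp : xi * (p - r * P) <= p ^+ 2.
    apply: (@le_trans _ _ (xi * (p - r * Q))).
      by rewrite ler_pM2l// lerD2l lerN2 ler_pM2l.
    have -> : p - r * Q = r * (p * green2 lambda xi - Q).
      by rewrite mulrBr [r * (p * _)]mulrCA e mulr1.
    have -> : p ^+ 2 = r * (p ^+ 2 * green2 lambda xi) by rewrite mulrCA e mulr1.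
    rewrite mulrCA ler_pM2l// -!avgZ -avgB -avgZ; apply: le_avg => i.
    have -> : p * (xi - lambda i) ^- 2 - p / ((xi - lambda i) * (x - lambda i)) =
      p ^+ 2 * (xi - lambda i) ^- 2 / (x - lambda i).
      by rewrite /p; field; rewrite !gt_eqF.
    rewrite mulrA ler_pdivrMr// mulrC ler_wpM2l//.
      by rewrite mulr_ge0 ?sqr_ge0// invr_ge0 sqr_ge0.
    by rewrite (le_trans (hY i))// lerD2r.
  have sx0 : 0 < Num.sqrt xi by rewrite sqrtr_gt0.
  have hk : Num.sqrt xi * Num.sqrt (p - r * P) <= p.
    by rewrite -sqrtrM ?(ltW xi0)// -[leRHS]ger0_norm// -sqrtr_sqr ler_wsqrtr.
  have h1 : b * r * Num.sqrt (p - r * P) <= 4 * p.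
    apply: (@le_trans _ _ (4 * Num.sqrt xi * Num.sqrt (p - r * P))).
      by rewrite ler_wpM2r ?sqrtr_ge0.
    by rewrite -mulrA ler_pM2l.
  rewrite -(ler_pM2l r0).
  have := ler_wpM2l (ltW r0) QP.
  lra.
pose v := Num.min p (T ^+ 2).
have xiv : xi <= v by rewrite /v le_min xip.
have vp : v <= p by rewrite /v ge_min lexx.
have v0 : 0 < v by exact: lt_le_trans xiv.
have hv : eta <= v <= T ^+ 2 by rewrite (le_trans (ltW exi))//= /v ge_min lexx orbT.
have kv : p - r * P <= v by rewrite /v le_min kT andbT; lra.
have : (6 * v)^-1 * (b * (v * Num.sqrt v)) <= Q.
  apply: avg_growth => // [|i|i vl].
  - by rewrite invr_ge0 mulr_ge0// ltW.
  - by rewrite divr_ge0// mulr_ge0// ltW.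
  rewrite ler_pdivlMr ?mulr_gt0// mulrC ler_pdivrMr ?mulr_gt0//.
  have -> : x - lambda i = (xi - lambda i) + p by rewrite /p; ring.
  have := Y0 i.
  have : xi - lambda i <= 2 * v by lra.
  move: (xi - lambda i) => Y; nra.
have -> : (6 * v)^-1 * (b * (v * Num.sqrt v)) = b / 6 * Num.sqrt v.
  by field; rewrite gt_eqF.
have : Num.sqrt (p - r * P) <= Num.sqrt v by exact: ler_wsqrtr.
have := sqrtr_ge0 (p - r * P).
move: (Num.sqrt (p - r * P)) (Num.sqrt v) => w1 w2 w10 w12 hw.
have : b * w1 <= b * w2 by rewrite ler_pM2l.
have : 0 <= b * w1 by rewrite mulr_ge0// ltW.
lra.
Qed.

End growth.

(** * From a slope bound to the growth of the square root *)

Section comparison.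
Context {R : realType}.
Variables (k : R -> R) (c s : R).
Hypothesis c01 : 0 <= c <= 1.

(** A discrete version of the comparison for [- k' >= 3 c sqrt k].  A step of
    length [h] with [c h <= sqrt k] raises [sqrt k] by at least [c h], because
    [(sqrt k + c h)^2 <= k + 3 c h sqrt k].  As [sqrt k] only grows backwards in
    time, steps of length [sqrt (k t)] are allowed throughout. *)
Lemma sqrt_growth_gt0 t :
  (forall r' r, s <= r' -> r' <= r -> r <= t -> 0 <= k r ->
    k r + (r - r') * (3 * c * Num.sqrt (k r)) <= k r') ->
  s <= t -> 0 < k t ->
  Num.sqrt (k t) + c * (t - s) <= Num.sqrt (k s).
Proof.
move=> k_slope st kt0; have /andP[c0 c1] := c01.
have st0 : 0 < Num.sqrt (k t) by rewrite sqrtr_gt0.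
suff H m s' : s <= s' <= t -> t - s' <= m%:R * Num.sqrt (k t) ->
    Num.sqrt (k t) + c * (t - s') <= Num.sqrt (k s').
  apply: (H (Num.bound ((t - s) / Num.sqrt (k t)))); first by rewrite lexx.
  by rewrite -ler_pdivrMr// ltW// archi_boundP// divr_ge0 ?subr_ge0// ltW.
elim: m s' => [|m IH] s' /andP[ss' s't].
  rewrite mul0r => h; have -> : s' = t by lra.
  by rewrite subrr mulr0 addr0.
move=> hm.
pose r := Num.min t (s' + Num.sqrt (k t)).
have rt : r <= t by rewrite ge_min lexx.
have rs : r <= s' + Num.sqrt (k t) by rewrite ge_min lexx orbT.
have s'r : s' <= r by rewrite le_min s't lerDl ltW.
have hr : Num.sqrt (k t) + c * (t - r) <= Num.sqrt (k r).
  apply: IH; first by rewrite rt (le_trans ss').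
  rewrite lerBlDr -lerBlDl le_min lerBlDr lerDl mulr_ge0 ?(ltW st0)//=.
  by move: hm; rewrite -natr1 mulrDl mul1r; lra.
have kr0 : 0 < Num.sqrt (k r).
  by apply: lt_le_trans hr; rewrite ltr_wpDr// mulr_ge0 ?subr_ge0.
have kr1 : 0 < k r by rewrite -sqrtr_gt0.
have kr : Num.sqrt (k r) ^+ 2 = k r by rewrite sqr_sqrtr// ltW.
have := k_slope _ _ ss' s'r rt (ltW kr1).
have hh : r - s' <= Num.sqrt (k r).
  apply: le_trans (_ : Num.sqrt (k t) <= _); first by rewrite lerBlDl.
  by apply: le_trans hr; rewrite lerDl mulr_ge0// subr_ge0.
rewrite -{1}kr => hk.
apply: (@le_trans _ _ (Num.sqrt (k r) + c * (r - s'))); first by move: hr; nra.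
have h0 : 0 <= r - s' by rewrite subr_ge0.
rewrite -[leLHS]ger0_norm ?addr_ge0 ?mulr_ge0 ?(ltW kr0)// -sqrtr_sqr ler_wsqrtr//.
apply: le_trans hk.
have : c * (r - s') <= Num.sqrt (k r).
  by apply: le_trans hh; rewrite ler_piMl.
have : 0 <= c * (r - s') by rewrite mulr_ge0.
move: (Num.sqrt _) (r - s') => u h; nra.
Qed.

(** When [k t = 0] no step is allowed from [t] itself, so the argument starts
    at earlier times, where [k] is positive, and passes to the limit. *)
Lemma sqrt_growth t :
  (forall r' r, s <= r' -> r' <= r -> r <= t -> 0 <= k r ->
    k r + (r - r') * (3 * c * Num.sqrt (k r)) <= k r') ->
  s <= t -> 0 <= k t ->
  (forall r, s <= r < t -> 0 < k r) ->
  Num.sqrt (k t) + c * (t - s) <= Num.sqrt (k s).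
Proof.
move=> k_slope st kt0 kpos; rewrite le_eqVlt in st; move: st => /predU1P[->|st].
  by rewrite subrr mulr0 addr0.
have /andP[c0 c1] := c01.
apply/ler_addgt0Pr => e e0.
pose r := Num.max s (t - e).
have rt : r < t by rewrite gt_max st gtrBl.
have sr : s <= r by rewrite le_max lexx.
have er : t - e <= r by rewrite le_max lexx orbT.
have kr0 : 0 < k r by apply: kpos; rewrite sr.
have -> : c * (t - s) = c * (r - s) + c * (t - r) by ring.
have ce : c * (t - r) <= e by nra.
have : Num.sqrt (k t) <= Num.sqrt (k r).
  apply: ler_wsqrtr; apply: le_trans (k_slope _ _ sr (ltW rt) (lexx _) kt0).
  by rewrite lerDl !mulr_ge0 ?subr_ge0 ?sqrtr_ge0 ?(ltW rt).
suff : Num.sqrt (k r) + c * (r - s) <= Num.sqrt (k s) by lra.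
apply: sqrt_growth_gt0 => // r1 r2 ? ? r2r ?.
by apply: k_slope => //; exact: le_trans r2r (ltW rt).
Qed.

End comparison.
(** * Integrals against an empirical law *)

Section empirical_integral.
Context {R : realType}.
Local Notation mR := (measurableTypeR R).

Lemma ge0_integral_empirical n (lambda : 'I_n -> R) (mu : probability mR R)
    (f : R -> R) : (0 < n)%N -> empirical_law lambda mu ->
  measurable_fun [set: mR] f -> (forall x, 0 <= f x) ->
  (\int[mu]_x (f x)%:E = (avg (fun i => f (lambda i)))%:E)%E.
Proof.
case: n lambda => [//|n] lambda _ emp mf f0.
have c0 : 0 <= n.+1%:R^-1 :> R by rewrite invr_ge0.
pose c : {nonneg R} := NngNum c0.
pose m k := @dirac _ mR (lambda (inord k)) R.
have mfE : measurable_fun [set: mR] (EFin \o f) by exact/measurable_EFinP.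
rewrite (eq_measure_integral (mscale c (msum m n.+1))); last first.
  move=> A mA _; apply: etrans (emp A mA) _.
  rewrite /mscale /= /msum; congr (_ * _)%E.
  by apply: eq_bigr => i _; rewrite /m inord_val.
rewrite ge0_integral_mscale//=; last by move=> x _; rewrite lee_fin.
rewrite ge0_integral_measure_sum//; last by move=> x _; rewrite lee_fin.
rewrite /avg EFinM -sumEFin; congr (_ * _)%E; apply: eq_bigr => i _.
by rewrite integral_dirac//= diracT mul1e inord_val.
Qed.

Lemma Rintegral_empirical n (lambda : 'I_n -> R) (mu : probability mR R)
    (f : R -> R) : (0 < n)%N -> empirical_law lambda mu ->
  measurable_fun [set: mR] f ->
  (\int[mu]_x f x)%R = avg (fun i => f (lambda i)).
Proof.
move=> n0 emp mf; rewrite /Rintegral integralE.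
under eq_integral do rewrite -[(fun x => (f x)%:E)]/(EFin \o f) funerpos.
under [X in (_ - X)%E]eq_integral do
  rewrite -[(fun x => (f x)%:E)]/(EFin \o f) funerneg.
rewrite !(ge0_integral_empirical _ _ _ _ n0 emp)//=; last 2 first.
- exact: measurable_funrneg.
- exact: measurable_funrpos.
rewrite -avgB; apply: eq_avg => i.
by rewrite -[in RHS](funrposBneg f).
Qed.

Lemma empirical_lawE n (lambda : 'I_n -> R) (mu : probability mR R)
    (A : set mR) : empirical_law lambda mu -> measurable A ->
  mu A = (avg (fun i => \1_A (lambda i)))%:E.
Proof.
by move=> emp mA; rewrite emp// /avg EFinM -sumEFin.
Qed.

End empirical_integral.

(** * Real coordinates of the Stieltjes transform and of the flow *)

Section complex_formulas.
Context {R : realType}.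
Local Notation mR := (measurableTypeR R).
Implicit Types (nu : probability mR R) (s x y a : R).

Lemma Re_resolvent s x y :
  complex.Re ((s%:C - (x +i* y))^-1) = - ((x - s) / ((x - s) ^+ 2 + y ^+ 2)).
Proof. by rewrite /= sub0r sqrrN -mulNr opprB -(sqrrN (x - s)) opprB. Qed.

Lemma Im_resolvent s x y :
  complex.Im ((s%:C - (x +i* y))^-1) = y / ((x - s) ^+ 2 + y ^+ 2).
Proof. by rewrite /= sub0r sqrrN mulNr opprK -(sqrrN (x - s)) opprB. Qed.

Lemma normc_sqrV s x y :
  (Normc.normc ((x +i* y) - s%:C) ^+ 2)^-1 = ((x - s) ^+ 2 + y ^+ 2)^-1.
Proof. by rewrite /= subr0 sqr_sqrtr// addr_ge0 ?sqr_ge0. Qed.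

Lemma continuous_cauchy_kernel x y : 0 < y ->
  continuous (fun s : R => ((x - s) ^+ 2 + y ^+ 2)^-1).
Proof.
move=> y0 s; apply: cvgV; first by rewrite gt_eqF// ltr_wpDl ?sqr_ge0 ?exprn_gt0.
apply: cvgD; last exact: cvg_cst.
by rewrite !expr2; apply: cvgM; apply: cvgB => //; exact: cvg_cst.
Qed.

Lemma measurable_cauchy_kernel x y : 0 < y ->
  measurable_fun [set: mR] (fun s : R => ((x - s) ^+ 2 + y ^+ 2)^-1).
Proof.
by move=> y0; apply: continuous_measurable_fun; exact: continuous_cauchy_kernel.
Qed.

Lemma measurable_poisson_kernel x y : 0 < y ->
  measurable_fun [set: mR] (fun s : R => y / ((x - s) ^+ 2 + y ^+ 2)).
Proof.
move=> y0; apply: measurable_funM; first exact: measurable_cst.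
exact: measurable_cauchy_kernel.
Qed.

Lemma Im_stieltjes nu x y : 0 < y ->
  (\int[nu]_s (y / ((x - s) ^+ 2 + y ^+ 2))%:E =
   (complex.Im (stieltjes nu (x +i* y)))%:E)%E.
Proof.
move=> y0.
have -> : complex.Im (stieltjes nu (x +i* y)) =
    (\int[nu]_s (y / ((x - s) ^+ 2 + y ^+ 2)))%R.
  by apply: eq_Rintegral => s _; exact: Im_resolvent.
rewrite /Rintegral fineK// ge0_fin_numE; last first.
  by apply: integral_ge0 => s _; rewrite lee_fin divr_ge0 ?addr_ge0 ?sqr_ge0// ltW.
apply: (@le_lt_trans _ _ (\int[nu]_s (y^-1)%:E)%E); last first.
  by rewrite integral_cst//= probability_setT mule1 ltry.
apply: ge0_le_integral => //.
- by move=> s _; rewrite lee_fin divr_ge0 ?addr_ge0 ?sqr_ge0// ltW.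
- by apply/measurable_EFinP; exact: measurable_poisson_kernel.
move=> s _; rewrite lee_fin ler_pdivrMr ?ltr_wpDl ?sqr_ge0 ?exprn_gt0//.
by rewrite ler_pdivlMl// -expr2 lerDr sqr_ge0.
Qed.

End complex_formulas.

Section flow_formulas.
Context {R : realType} {n : nat}.
Local Notation mR := (measurableTypeR R).
Variables (lambda : 'I_n -> R) (mu : probability mR R).
Hypotheses (n_gt0 : (0 < n)%N) (emp : empirical_law lambda mu).

Lemma stieltjes_empirical x y : 0 < y ->
  stieltjes mu (x +i* y) = (- cgreen lambda x y) +i* (y * pois lambda x y).
Proof.
move=> y0; rewrite /stieltjes.
under eq_Rintegral do rewrite Re_resolvent.
under [X in _ +i* X]eq_Rintegral do rewrite Im_resolvent.
have mk := measurable_cauchy_kernel x y y0.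
rewrite !(Rintegral_empirical _ _ _ _ n_gt0 emp).
- rewrite -avgZ /cgreen -mulN1r -avgZ; congr (_ +i* _).
  by apply: eq_avg => i; rewrite mulN1r.
- exact: measurable_poisson_kernel.
- apply: measurableT_comp => //; apply: measurable_funM => //.
  by apply: measurable_funB => //; exact: measurable_cst.
Qed.

Lemma char_flow_empirical r x y : 0 < y ->
  char_flow mu r (x +i* y) =
  (x + r * cgreen lambda x y) +i* (y * (1 - r * pois lambda x y)).
Proof.
move=> y0; rewrite /char_flow stieltjes_empirical//=.
by congr (_ +i* _); ring.
Qed.

Lemma Lambda_empirical r x y : 0 <= r ->
  Lambda mu r (x +i* y) <-> 0 < y /\ r * pois lambda x y < 1.
Proof.
move=> r0; rewrite /Lambda /upper_half_plane; case: eqVneq => [->|rn0] /=.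
  by rewrite mul0r; split => [|[]].
have {}r0 : 0 < r by rewrite lt_neqAle eq_sym rn0.
suff E : 0 < y -> (\int[mu]_s ((Normc.normc ((x +i* y) - s%:C) ^+ 2)^-1)%:E =
   (pois lambda x y)%:E)%E.
  split=> -[y0]; first by rewrite E// lte_fin -[_^-1]mul1r ltr_pdivlMr// mulrC.
  by move=> h; split => //; rewrite E// lte_fin -[_^-1]mul1r ltr_pdivlMr// mulrC.
move=> y0; under eq_integral do rewrite normc_sqrV.
rewrite (ge0_integral_empirical _ _ _ _ n_gt0 emp)//.
  exact: measurable_cauchy_kernel.
by move=> s; rewrite invr_ge0 addr_ge0 ?sqr_ge0.
Qed.

End flow_formulas.

(** * Poisson integrals and local mass *)

Section poisson.
Context {R : realType}.
Local Notation mR := (measurableTypeR R).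
Implicit Types nu : probability mR R.

(** The kernel [y / ((x - s)^2 + y^2)] is at least [y / (5 d^2)] on the
    interval, since there [|x - s| <= 2 d]. *)
Lemma poisson_mass_ge nu (x y z d : R) : 0 < y -> 0 < d ->
  `|x - z| <= d -> y <= d ->
  (nu `[(z - d)%R, (z + d)%R]%classic <=
    (5 * d ^+ 2 / y * complex.Im (stieltjes nu (x +i* y)))%:E)%E.
Proof.
move=> y0 d0 xz yd; rewrite EFinM -Im_stieltjes//.
have mk := measurable_poisson_kernel x y y0.
have k0 s : 0 <= y / ((x - s) ^+ 2 + y ^+ 2).
  by rewrite divr_ge0 ?addr_ge0 ?sqr_ge0// ltW.
have c0 : 0 <= 5 * d ^+ 2 / y by rewrite divr_ge0 ?(ltW y0)// mulr_ge0 ?sqr_ge0.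
rewrite -ge0_integralZl_EFin//; last 2 first.
- by move=> s _; rewrite lee_fin.
- exact/measurable_EFinP.
have mI : measurable (`[z - d, z + d]%classic : set mR) by exact: measurable_itv.
rewrite -[leLHS]mul1e -(integral_cst _ mI) integral_mkcond/=.
apply: ge0_le_integral => //.
- by move=> s _; rewrite patchE; case: ifP; rewrite lee_fin.
- by apply/measurable_restrict.
- by apply/measurable_EFinP; apply: measurable_funM => //; exact: measurable_cst.
move=> s _; rewrite patchE; case: ifP => [/set_mem|_]; last first.
  by rewrite -EFinM lee_fin mulr_ge0.
rewrite /= in_itv/= => /andP[h1 h2]; rewrite -EFinM lee_fin.
rewrite mulrA divfK ?gt_eqF// ler_pdivlMr ?ltr_wpDl ?sqr_ge0 ?exprn_gt0// mul1r.
move: xz; rewrite ler_norml => /andP[h3 h4].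
nra.
Qed.

(** Off the null interval [|x - s| >= d / 2]; on it the kernel is still bounded,
    by [1 / y]. *)
Lemma poisson_mass_le nu (x y z d : R) : 0 < y -> 0 < d ->
  `|x - z| <= d / 2 -> nu `]z - d, z + d[%classic = 0%E ->
  complex.Im (stieltjes nu (x +i* y)) <= 4 / d ^+ 2 * y.
Proof.
move=> y0 d0 xz nu0; rewrite -lee_fin -Im_stieltjes//.
have mI : measurable (`]z - d, z + d[%classic : set mR) by exact: measurable_itv.
have c0 : 0 <= 4 / d ^+ 2 * y by rewrite mulr_ge0 ?(ltW y0)// divr_ge0 ?sqr_ge0.
have yi0 : 0 <= y^-1 by rewrite invr_ge0 ltW.
apply: (@le_trans _ _ (\int[nu]_s ((4 / d ^+ 2 * y)%:E +
    (y^-1)%:E * (\1_(`]z - d, z + d[%classic : set mR) s)%:E))%E).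
  apply: ge0_le_integral => //.
  - by move=> s _; rewrite lee_fin divr_ge0 ?addr_ge0 ?sqr_ge0// ltW.
  - by apply/measurable_EFinP; exact: measurable_poisson_kernel.
  - apply/measurable_EFinP; apply: measurable_funD; first exact: measurable_cst.
    by apply: measurable_funM; first exact: measurable_cst.
  move=> s _; rewrite -EFinM -EFinD lee_fin.
  rewrite ler_pdivrMr ?ltr_wpDl ?sqr_ge0 ?exprn_gt0// indicE.
  case: (boolP (s \in _)) => [_|]; rewrite ?mulr1 ?mulr0 ?addr0.
    apply: (@le_trans _ _ (y^-1 * y ^+ 2)).
      by rewrite expr2 mulKf// gt_eqF.
    rewrite mulrDl ler_wpDl ?mulr_ge0 ?addr_ge0 ?sqr_ge0 ?(ltW y0)//.
      by rewrite invr_ge0 sqr_ge0.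
    by rewrite ler_wpM2l// lerDr sqr_ge0.
  rewrite notin_setE /= in_itv/= => /negP; rewrite negb_and -!leNgt => hs.
  have : d / 2 <= `|x - s|.
    rewrite ler_normr; move: xz; rewrite ler_norml => /andP[h1 h2].
    by case/orP: hs => h; apply/orP; [left|right]; lra.
  rewrite -(ler_pXn2r (n:=2))// ?nnegrE ?divr_ge0 ?(ltW d0)//.
  rewrite real_normK ?num_real// => h.
  rewrite mulrAC ler_peMl ?(ltW y0)// mulrC mulrA ler_pdivlMr ?exprn_gt0//.
  move: h; rewrite expr_div_n; have := sqr_ge0 y; lra.
rewrite ge0_integralD//; last first.
- by apply/measurable_EFinP; apply: measurable_funM; first exact: measurable_cst.
- by move=> s _; rewrite -EFinM lee_fin mulr_ge0.
rewrite ge0_integralZl_EFin//; last exact/measurable_EFinP.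
have -> : (\int[nu]_s (\1_(`]z - d, z + d[%classic : set mR) s)%:E = 0)%E.
  by rewrite integral_indic// setIT; exact: nu0.
rewrite mule0 adde0 integral_cst//=.
by rewrite probability_setT mule1.
Qed.

(** Cutting an interval into two halves, and each half again, divides the
    quadratic bound by two at every generation. *)
Lemma null_of_quadratic nu (c0 K : R) :
  (forall z d : R, c0 <= z -> 0 < d ->
    (nu `[(z - d)%R, (z + d)%R]%classic <= (K * d ^+ 2)%:E)%E) ->
  forall c d, c0 <= c -> c < d -> nu `[c, d]%classic = 0%E.
Proof.
move=> hK.
have K0 : 0 <= K.
  by have := hK c0 1 (lexx _) ltr01; rewrite expr1n mulr1 -lee_fin; apply: le_trans.
have step m : forall c d : R, c0 <= c -> c < d ->
    (nu `[c, d]%classic <= (K * (d - c) ^+ 2 * (2 ^- m))%:E)%E.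
  elim: m => [|m IH] c d c0c cd.
    have := hK ((c + d) / 2) ((d - c) / 2).
    have -> : (c + d) / 2 - (d - c) / 2 = c by field.
    have -> : (c + d) / 2 + (d - c) / 2 = d by field.
    move=> h; apply: le_trans (h _ _) _; [lra|lra|].
    rewrite lee_fin expr0 invr1 mulr1 ler_wpM2l//.
    nra.
  pose e := (c + d) / 2.
  have ce : c < e by rewrite /e; lra.
  have ed : e < d by rewrite /e; lra.
  have -> : `[c, d]%classic = `[c, e]%classic `|` `[e, d]%classic :> set R.
    apply/seteqP; split => x /=; rewrite !in_itv/=; last by move=> [] /andP[]; lra.
    move=> /andP[]; case: (leP x e) => h h1 h2; [left|right];
      by apply/andP; split=> //; exact: ltW.
  apply: le_trans (measureU2 _ _ _) _; try exact: measurable_itv.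
  apply: le_trans (leeD (IH _ _ c0c ce) (IH _ _ _ ed)) _; first lra.
  rewrite -EFinD lee_fin (exprS (2 : R) m) /e le_eqVlt.
  apply/predU1P; left; field.
  by rewrite expf_neq0.
move=> c d c0c cd; apply/eqP; rewrite eq_le measure_ge0 andbT.
rewrite -[0%E]/(0%:E).
have fin : nu `[c, d]%classic \is a fin_num by exact: fin_num_measure.
rewrite -(fineK fin) lee_fin leNgt; apply/negP => v0.
set v := fine _ in v0.
pose L := K * (d - c) ^+ 2.
have hm m : v * m%:R <= L.
  have := step m c d c0c cd; rewrite -(fineK fin) lee_fin -/v -/L => h.
  have : v * 2 ^+ m <= L by rewrite -ler_pdivlMr ?exprn_gt0.
  apply: le_trans; rewrite ler_pM2l// -natrX ler_nat ltnW// ltn_expl//.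
have L0 : 0 <= L by rewrite mulr_ge0 ?sqr_ge0.
have := hm (Num.bound (L / v)).
rewrite leNgt mulrC -ltr_pdivrMr// archi_boundP// divr_ge0// ltW//.
Qed.

End poisson.
(** * The right edge along the flow *)

Lemma exists_small {R : realType} (K1 K2 c1 c2 c3 : R) :
  0 <= K1 -> 0 <= K2 -> 0 < c1 -> 0 < c2 -> 0 < c3 ->
  exists2 e, 0 < e <= 1 & [/\ e ^+ 2 * K1 <= c1, e ^+ 2 * K2 < c2 & e <= c3].
Proof.
move=> K10 K20 c10 c20 c30.
have k1 : 0 < K1 + 1 by rewrite ltr_wpDl.
have k2 : 0 < K2 + 1 by rewrite ltr_wpDl.
pose e := Num.min 1 (Num.min c3 (Num.min (c1 / (K1 + 1)) (c2 / (K2 + 1)))).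
have e0 : 0 < e by rewrite !lt_min ltr01 c30 !divr_gt0.
have e1 : e <= 1 by rewrite ge_min lexx.
have e3 : e <= c3 by rewrite !ge_min lexx orbT.
have : e <= c1 / (K1 + 1) by rewrite !ge_min lexx !orbT.
have : e <= c2 / (K2 + 1) by rewrite !ge_min lexx !orbT.
rewrite !ler_pdivlMr// => h2 h1.
have ee : e ^+ 2 <= e by rewrite expr2 ler_piMl// ltW.
exists e; first by rewrite e0.
split => //.
  by have := ler_wpM2r K10 ee; lra.
by have := ler_wpM2r K20 ee; lra.
Qed.

Section right_edge_flow.
Context {R : realType}.
Local Notation mR := (measurableTypeR R).

Lemma right_edgeE (nu : probability mR R) (E : R) :
  supp nu E -> (forall y, E < y -> ~ supp nu y) -> right_edge nu = E.
Proof.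
move=> sE hE; rewrite /right_edge; apply: xget_subset1.
  by split => // y sy; rewrite leNgt; apply/negP => /hE.
move=> a b [sa ua] [sb ub].
by apply/eqP; rewrite eq_le ub//= ua.
Qed.

Context {n : nat}.
Variables (lambda : 'I_n -> R) (mu nu : probability mR R) (r : R).
Hypotheses (n_gt0 : (0 < n)%N) (emp : empirical_law lambda mu).
Hypotheses (r_ge0 : 0 <= r) (fc : is_free_conv_sc mu r nu).

(** All that is ever used of [nu]: its Poisson integral is known along the image
    of the flow. *)
Lemma Im_stieltjes_flow x y : 0 < y -> r * pois lambda x y < 1 ->
  complex.Im (stieltjes nu
    ((x + r * cgreen lambda x y) +i* (y * (1 - r * pois lambda x y)))) =
  y * pois lambda x y.
Proof.
move=> y0 hS.
have hL : Lambda mu r (x +i* y) by apply/(Lambda_empirical lambda mu n_gt0 emp).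
have := fc _ hL.
rewrite (char_flow_empirical lambda mu n_gt0 emp)// => ->.
by rewrite (stieltjes_empirical lambda mu n_gt0 emp).
Qed.

(** Every real [z] to the right of [edge_map r x1] is [edge_map r x0] for some
    [x0 >= x1].  The flow sends [x0 + i e] to a point close to [z], of imaginary
    part [e (1 - r S)] where the Poisson integral is [e S], with
    [S <= green2 x1].  The ratio is bounded uniformly in [e], whence a mass
    [O(d^2)] for the interval of radius [d] around [z]. *)
Lemma flow_null x1 : right_of lambda x1 -> r * green2 lambda x1 < 1 ->
  forall c d, edge_map lambda r x1 <= c -> c < d -> nu `[c, d]%classic = 0%E.
Proof.
move=> rx1 hg.
apply: (@null_of_quadratic _ _ _
  (5 * green2 lambda x1 / (1 - r * green2 lambda x1))) => z d hz d0.
have [x0 [x10 ez]] := edge_map_onto lambda r x1 z r_ge0 rx1 hz.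
have rx0 := right_ofW lambda rx1 x10.
pose Q := avg (fun i => (x0 - lambda i) ^- 3).
have Q0 : 0 <= Q.
  by apply: avg_ge0 => i; rewrite invr_ge0 exprn_ge0// subr_ge0 ltW.
have [e /andP[e0 e1] [h1 _ ed]] := exists_small (r * Q) 0 d 1 d
  (mulr_ge0 r_ge0 Q0) (lexx _) d0 ltr01 d0.
set S := pois lambda x0 e.
have S0 : 0 <= S by apply: avg_ge0 => i; rewrite invr_ge0 ltW// dist2_gt0.
have Sg : S <= green2 lambda x1.
  exact: le_trans (pois_le_green2 _ _ _ rx0) (green2_anti _ _ _ rx1 x10).
have rS : r * S <= r * green2 lambda x1 by rewrite ler_wpM2l.
have rS1 : r * S < 1 by exact: le_lt_trans hg.
have Y0 : 0 < e * (1 - r * S) by rewrite mulr_gt0 ?subr_gt0.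
have Yd : e * (1 - r * S) <= d.
  by apply: le_trans ed; rewrite ler_piMr ?(ltW e0)// lerBlDr lerDl mulr_ge0.
have /andP[g0 gQ] := cgreen_close lambda x0 e rx0.
have hX : `|x0 + r * cgreen lambda x0 e - z| <= d.
  rewrite -ez /edge_map opprD addrACA subrr add0r -mulrBr normrM ger0_norm//.
  rewrite distrC ger0_norm//; apply: le_trans h1; rewrite mulrCA.
  by rewrite ler_wpM2l.
apply: le_trans (poisson_mass_ge nu _ _ z d Y0 d0 hX Yd) _.
rewrite Im_stieltjes_flow// lee_fin -/S.
have -> : 5 * d ^+ 2 / (e * (1 - r * S)) * (e * S) = 5 * d ^+ 2 * (S / (1 - r * S)).
  by field; rewrite !gt_eqF ?subr_gt0.
have -> : 5 * green2 lambda x1 / (1 - r * green2 lambda x1) * d ^+ 2 =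
  5 * d ^+ 2 * (green2 lambda x1 / (1 - r * green2 lambda x1)) by ring.
rewrite ler_wpM2l//; first by rewrite mulr_ge0 ?sqr_ge0.
rewrite ler_pM ?invr_ge0 ?subr_ge0 ?(ltW rS1)//.
by rewrite lef_pV2 ?posrE ?subr_gt0// lerD2l lerN2.
Qed.

Lemma notin_supp_flow x1 y : right_of lambda x1 -> r * green2 lambda x1 < 1 ->
  edge_map lambda r x1 < y -> ~ supp nu y.
Proof.
move=> rx1 hg hy /(_ `]edge_map lambda r x1, y + 1[%classic).
have Uy : edge_map lambda r x1 < y < y + 1 by rewrite hy ltrDl ltr01.
move=> /(_ (interval_open _ _)) h.
have : (0 < nu `]edge_map lambda r x1, (y + 1)%R[%classic)%E.
  by apply: h => //=; rewrite in_itv.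
apply/negP; rewrite -leNgt.
rewrite -(flow_null _ rx1 hg _ (y + 1) (lexx _)); last first.
  by case/andP: Uy; exact: lt_trans.
apply: le_measure; rewrite ?inE; try exact: measurable_itv.
by apply: subset_itvW.
Qed.

(** Along [xi + i y] the ratio of the Poisson integral to the imaginary part is
    [S / (1 - r S)] with [S] tending to [green2 xi = 1 / r], so it is unbounded;
    it would stay bounded if a neighbourhood of the limit point had mass [0]. *)
Lemma preedge_in_supp xi : 0 < r -> preedge lambda r xi ->
  supp nu (edge_map lambda r xi).
Proof.
move=> r0 [rxi e] U oU UE.
rewrite lt0e measure_ge0 andbT; apply/eqP => U0.
have /nbhs_ballP[d0 /= d00 hd] : nbhs (edge_map lambda r xi) U.
  exact: open_nbhs_nbhs.
set E := edge_map lambda r xi in UE hd *.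
have nu0 : nu `]E - d0, E + d0[%classic = 0%E.
  apply/eqP; rewrite eq_le measure_ge0 andbT -U0.
  apply: le_measure; rewrite ?inE; first exact: measurable_itv.
    exact: open_measurable.
  by move=> s /=; rewrite in_itv/= => hs; apply: hd; rewrite /ball/= ltr_distlC.
pose Q3 := avg (fun i => (xi - lambda i) ^- 3).
pose Q4 := avg (fun i => (xi - lambda i) ^- 4).
have Q30 : 0 <= Q3.
  by apply: avg_ge0 => i; rewrite invr_ge0 exprn_ge0// subr_ge0 ltW.
have Q40 : 0 <= Q4.
  by apply: avg_ge0 => i; rewrite invr_ge0 exprn_ge0// subr_ge0 ltW.
have g0 : 0 < green2 lambda xi.
  by rewrite -(ltr_pM2l r0) mulr0 e ltr01.
have K0 : 0 <= Q4 * (1 + 4 / d0 ^+ 2 * r).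
  by rewrite mulr_ge0// addr_ge0// mulr_ge0// divr_ge0// sqr_ge0.
(* With [w = 4 / d0^2], the contradiction arises as soon as
   [green2 xi - S <= y^2 Q4] and [S <= w (1 - r S) <= w r y^2 Q4], i.e. when
   [y^2 Q4 (1 + w r) < green2 xi]. *)
have [y /andP[y0 y1] [h1 h2 _]] :=
  exists_small (r * Q3) _ (d0 / 2) (green2 lambda xi) 1
  (mulr_ge0 r_ge0 Q30) K0 (divr_gt0 d00 (ltr0n _ 2)) g0 ltr01.
set S := pois lambda xi y.
have pc : green2 lambda xi - S <= y ^+ 2 * Q4 by exact: pois_close.
have Slt : S < green2 lambda xi.
  rewrite -subr_gt0 -avgB; apply: avg_gt0 => // i.
  have h : 0 < xi - lambda i by rewrite subr_gt0.
  rewrite subr_gt0 ltf_pV2 ?posrE ?dist2_gt0 ?exprn_gt0//.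
  by rewrite ltrDl exprn_gt0.
have rS1 : r * S < 1 by rewrite -e ltr_pM2l.
have Y0 : 0 < y * (1 - r * S) by rewrite mulr_gt0 ?subr_gt0.
have /andP[c0 cQ] := cgreen_close lambda xi y rxi.
have hX : `|xi + r * cgreen lambda xi y - E| <= d0 / 2.
  rewrite /E /edge_map opprD addrACA subrr add0r -mulrBr normrM ger0_norm//.
  rewrite distrC ger0_norm//; apply: le_trans h1; rewrite mulrCA.
  by rewrite ler_wpM2l.
have := poisson_mass_le nu _ _ _ _ Y0 d00 hX nu0.
rewrite Im_stieltjes_flow// -/S [leRHS]mulrCA ler_pM2l//.
have d20 : 0 <= 4 / d0 ^+ 2 by rewrite divr_ge0// sqr_ge0.
have : r * (green2 lambda xi - S) <= r * (y ^+ 2 * Q4) by rewrite ler_pM2l.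
rewrite mulrBr e; move: (4 / d0 ^+ 2) d20 h2 pc => w w0 h2 pc h3 h4.
have := ler_wpM2l w0 h3; lra.
Qed.

Lemma right_edge_flow xi : 0 < r -> preedge lambda r xi ->
  right_edge nu = edge_map lambda r xi.
Proof.
move=> r0 pxi; have [rxi e] := pxi.
apply: right_edgeE; first exact: preedge_in_supp.
move=> y hy.
pose y' := (edge_map lambda r xi + y) / 2.
have [x1 [xx1 e1]] : exists x1, [/\ xi <= x1 & edge_map lambda r x1 = y'].
  by apply: edge_map_onto => //; rewrite /y'; lra.
have lt1 : xi < x1.
  rewrite lt_neqAle xx1 andbT; apply/eqP => xe.
  by move: e1; rewrite -xe /y'; lra.
apply: (notin_supp_flow x1); first exact: right_ofW rxi xx1.
  by rewrite -e ltr_pM2l// green2_lt.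
by rewrite e1 /y'; lra.
Qed.

End right_edge_flow.

Section initial_edge.
Context {R : realType} {n : nat}.
Variables (lambda : 'I_n -> R) (mu : probability (measurableTypeR R) R).
Hypotheses (n_gt0 : (0 < n)%N) (emp : empirical_law lambda mu).

Lemma atom_in_supp k : supp mu (lambda k).
Proof.
move=> U oU Uk; rewrite (empirical_lawE _ _ _ _ emp); last exact: open_measurable.
rewrite lte_fin; apply: lt_le_trans (le_term_avg _ k _) => //.
by rewrite indicE mem_set// mulr1 invr_gt0 ltr0n.
Qed.

Lemma right_edge_initial : is_free_conv_sc mu 0 mu ->
  exists k, right_edge mu = lambda k.
Proof.
move=> fc; have [k hk] := exists_max lambda n_gt0; exists k.
apply: right_edgeE; first exact: atom_in_supp.
move=> y hy.
apply: (notin_supp_flow lambda mu mu 0 n_gt0 emp (lexx _) fc ((lambda k + y) / 2)).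
- by move=> i; have := hk i; lra.
- by rewrite mul0r ltr01.
- by rewrite /edge_map mul0r; lra.
Qed.

End initial_edge.
(** * Convexity of [kappa] and its slope *)

Section flow.
Context {R : realType} {n : nat}.
Variables (lambda : 'I_n -> R) (mu : R -> probability (measurableTypeR R) R).
Hypotheses (n_gt0 : (0 < n)%N) (emp : empirical_law lambda (mu 0)).
Hypothesis fc : forall r : R, 0 <= r -> is_free_conv_sc (mu 0) r (mu r).
Variables (x y : R).
Hypothesis y_gt0 : 0 < y.

Local Notation kappa := (kappa_flow mu (x +i* y)).
Local Notation eta := (eta_flow mu (x +i* y)).
Local Notation S := (pois lambda x y).
Local Notation slope xi := (green lambda xi - cgreen lambda x y).

Lemma eta_flowE r : eta r = y * (1 - r * S).
Proof. by rewrite /eta_flow (char_flow_empirical lambda _ n_gt0 emp). Qed.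

Lemma kappa_flowE r xi : 0 < r -> preedge lambda r xi ->
  kappa r = x - xi - r * slope xi.
Proof.
move=> r0 pxi; rewrite /kappa_flow (char_flow_empirical lambda _ n_gt0 emp)//=.
rewrite (right_edge_flow _ _ _ _ n_gt0 emp (ltW r0) (fc _ (ltW r0)) xi)//.
by rewrite /edge_map; ring.
Qed.

Lemma right_edge_le r xi : 0 <= r -> right_of lambda xi ->
  right_edge (mu r) <= edge_map lambda r xi.
Proof.
rewrite le_eqVlt => /predU1P[<- rxi|r0 rxi].
  have [k ->] := right_edge_initial _ _ n_gt0 emp (fc 0 (lexx _)).
  by rewrite /edge_map mul0r addr0 ltW.
have [xi' pxi'] := preedge_exists lambda r n_gt0 r0.
rewrite (right_edge_flow _ _ _ _ n_gt0 emp (ltW r0) (fc _ (ltW r0)) xi')//.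
exact: edge_map_min (ltW r0) pxi' rxi.
Qed.

(** Equality holds at [r' = r], and at other times [edge_map r' xi] is an upper
    bound for the edge. *)
Lemma kappa_convex r r' xi : 0 < r -> preedge lambda r xi -> 0 <= r' ->
  kappa r + (r - r') * slope xi <= kappa r'.
Proof.
move=> r0 pxi r'0; rewrite (kappa_flowE r xi r0 pxi).
rewrite /kappa_flow (char_flow_empirical lambda _ n_gt0 emp)//=.
have := right_edge_le r' xi r'0 (proj1 pxi).
by rewrite /edge_map; lra.
Qed.

Lemma slope_gt_ratio r xi : 0 < r -> r * S < 1 -> preedge lambda r xi ->
  y * S * (kappa r / eta r) < slope xi.
Proof.
move=> r0 rS pxi; have [rxi _] := pxi.
have h : 0 < 1 - r * S by rewrite subr_gt0.
rewrite eta_flowE; have -> : y * S * (kappa r / (y * (1 - r * S))) =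
    S * kappa r / (1 - r * S).
  by field; rewrite !gt_eqF.
rewrite ltr_pdivrMr// (kappa_flowE r xi r0 pxi).
have := slope_gt lambda x y xi n_gt0 y_gt0 rxi; lra.
Qed.

End flow.

(** * The threshold function *)

Lemma powR32 {R : realType} (v : R) : 0 <= v -> v `^ (3 / 2) = v * Num.sqrt v.
Proof.
rewrite le_eqVlt => /predU1P[<-|v0].
  by rewrite mul0r powR0// gt_eqF//; lra.
have -> : 3 / 2 = 1 + 2^-1 :> R by field.
by rewrite powRD ?(gt_eqF v0) ?implybT// powRr1 ?(ltW v0)// powR12_sqrt// ltW.
Qed.

Lemma bigC_ge {R : realType} (b : R) : 0 < b < 1 -> 2 ^+ 21 <= b * bigC b.
Proof.
move=> /andP[b0 b1]; rewrite /bigC mulrCA ler_peMr ?exprn_ge0//.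
by rewrite expr2 invfM mulrA mulfV ?gt_eqF// mul1r invf_ge1 ?ltW.
Qed.

Lemma smallc_bounds {R : realType} (b : R) : 0 < b < 1 ->
  0 <= smallc b <= b / 6.
Proof.
move=> hb; have /andP[b0 b1] := hb.
have hC := bigC_ge b hb.
have h6 : 6 <= 2 ^+ 21 :> R by rewrite -natrX ler_nat.
have C6 : 6 <= bigC b.
  apply: le_trans h6 _; apply: le_trans hC _; rewrite ler_piMl ?(ltW b1)//.
  by rewrite divr_ge0 ?exprn_ge0 ?(ltW b0).
rewrite /smallc mulr_ge0 ?powR_ge0 ?(ltW b0)//= ler_pM2l//.
apply: (@le_trans _ _ (bigC b `^ (- 1))).
  by apply: ler_powR; [apply: le_trans C6; rewrite ler1n|lra].
have C0 : 0 < bigC b by exact: lt_le_trans C6.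
by rewrite powR_inv1 ?(ltW C0)// lef_pV2 ?posrE.
Qed.

Lemma max_affine_le {R : realType} (b c A L s t : R) : 0 <= c -> A <= s <= t ->
  Num.max (b - c * Num.max 0 (s - A)) L <=
  Num.max (b - c * Num.max 0 (t - A)) L + c * (t - s).
Proof.
move=> c0 /andP[As st].
have At := le_trans As st.
have pos r : A <= r -> Num.max 0 (r - A) = r - A.
  by move=> Ar; apply: max_idPr; rewrite subr_ge0.
rewrite !pos//.
rewrite ge_max; apply/andP; split.
  rewrite -lerBlDr le_max; apply/orP; left; lra.
apply: ler_wpDr; last by rewrite le_max lexx orbT.
by rewrite mulr_ge0// subr_ge0.
Qed.

(** Half of [ks] is bounded below by [(kt + d D) / 2] and the other half by
    [(sqrt kt + c d)^2 / 2]; what is left after [d D / 2] is at least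
    [(sqrt kt + c d / 2)^2]. *)
Lemma combine_growth {R : realType} (ks kt gs gt d c D : R) :
  0 <= gs -> 0 <= gt -> gt ^+ 2 <= kt -> 0 <= ks -> 0 <= c -> 0 <= d ->
  gs <= gt + c / 2 * d ->
  Num.sqrt kt + c * d <= Num.sqrt ks -> kt + d * D <= ks -> 
  d / 2 * D <= ks - gs ^+ 2.
Proof.
move=> gs0 gt0 gk ks0 c0 d0 hg hk hD.
have kt0 : 0 <= kt by apply: le_trans gk; exact: sqr_ge0.
have gt_le : gt <= Num.sqrt kt.
  by rewrite -(ger0_norm gt0) -sqrtr_sqr ler_wsqrtr.
have cd : 0 <= c * d by rewrite mulr_ge0.
set w := Num.sqrt kt in hk gt_le *.
have w0 : 0 <= w by exact: sqrtr_ge0.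
have e1 : w ^+ 2 = kt by rewrite sqr_sqrtr.
have e2 : (w + c * d) ^+ 2 <= ks.
  by rewrite -[leRHS]sqr_sqrtr// ler_pXn2r ?nnegrE ?addr_ge0 ?sqrtr_ge0.
have : gs ^+ 2 <= (w + c / 2 * d) ^+ 2.
  by rewrite ler_pXn2r ?nnegrE//; lra.
have := sqr_ge0 (c * d); lra.
Qed.

Lemma edge_bound_const {R : realType} n (b etas s : R) :
  s <= bigC b * Num.sqrt etas ->
  edge_bound n b etas s = edge_bound n b etas (bigC b * Num.sqrt etas).
Proof.
move=> sA; rewrite /edge_bound subrr maxxx.
by have /max_idPl -> : s - bigC b * Num.sqrt etas <= 0 by rewrite subr_le0.
Qed.

(** * The lower bounds on [kappa] *)

Theorem lemma3p3 (R : realType) (T b etas : R) (n : nat) (lambda : 'I_n -> R)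
    (mu : R -> probability (measurableTypeR R) R)
    (hT : 100 <= T) (hb : 0 < b < 1) (hetas : 0 < etas < 1 / 4)
    (hn : (0 < n)%N)
    (hmu0 : empirical_law lambda (mu 0))
    (hmu : forall r : R, 0 <= r -> is_free_conv_sc (mu 0) r (mu r))
    (hsupp : supp (mu 0) `<=` `]-oo, 0])
    (hgrowth : forall x : R, etas <= x <= T ^+ 2 ->
       ((b * x `^ (3 / 2))%:E <= mu 0%R `[(- x)%R, 0%R]%classic)%E)
    (hC : ln n%:R ^+ 15 / n%:R `^ (2 / 3) <= bigC b ^+ 2 * etas)
    (t s : R) (ht : 0 < t <= T) (hs : 0 <= s <= t)
    (u : R[i]) (hu : Lambda (mu 0) t u)
    (hkappas : kappa_flow mu u s <= T ^+ 2) :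
  (edge_bound n b etas t <= kappa_flow mu u t ->
   bigC b * Num.sqrt etas <= s <= t ->
   (t - s) / 2 * complex.Im (stieltjes (mu t) (char_flow (mu 0) t u))
     * (kappa_flow mu u t / eta_flow mu u t)
     <= kappa_flow mu u s - edge_bound n b etas s)
  /\
  (let tt := Num.min t (bigC b * Num.sqrt etas) in
   edge_bound n b etas t <= kappa_flow mu u t ->
   0 <= s <= tt ->
   (tt - s) * complex.Im (stieltjes (mu t) (char_flow (mu 0) t u))
     * (kappa_flow mu u tt / eta_flow mu u tt)
     <= kappa_flow mu u s - edge_bound n b etas s).
Proof.
case: u hu hkappas => x y hu hks.
have /andP[t0 tT] := ht; have /andP[b0 b1] := hb; have /andP[e0 e4] := hetas.
have [y0 tS] := (Lambda_empirical lambda (mu 0) hn hmu0 t x y (ltW t0)).1 hu.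
have -> : complex.Im (stieltjes (mu t) (char_flow (mu 0) t (x +i* y))) =
    y * pois lambda x y.
  by rewrite (hmu _ (ltW t0) _ hu) (stieltjes_empirical lambda _ hn hmu0).
have S0 : 0 <= pois lambda x y.
  by apply: avg_ge0 => i; rewrite invr_ge0 ltW// dist2_gt0.
have rS r : r <= t -> r * pois lambda x y < 1.
  by move=> rt; apply: le_lt_trans tS; rewrite ler_wpM2r.
have lam0 i : lambda i <= 0.
  by have := hsupp _ (atom_in_supp lambda (mu 0) hn hmu0 i); rewrite /= in_itv.
have T1 : 1 <= T by lra.
have etaT : etas < T ^+ 2.
  by have : 1 <= T ^+ 2 by [rewrite exprn_ege1|]; lra.
have gr v : etas <= v <= T ^+ 2 ->
    b * (v * Num.sqrt v) <= avg (fun i => (- v <= lambda i)%R%:R).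
  move=> hv; have := hgrowth v hv; have /andP[ev _] := hv.
  rewrite (empirical_lawE _ _ _ _ hmu0); last exact: measurable_itv.
  rewrite lee_fin powR32; last by rewrite (le_trans (ltW e0)).
  move=> h; apply: le_trans h _; apply: le_avg => i.
  by rewrite indicE mem_setE in_itv/= lam0 andbT.
set kappa := kappa_flow mu (x +i* y) in hks *.
set eta := eta_flow mu (x +i* y).
set S := pois lambda x y in S0 rS tS *.
set A := bigC b * Num.sqrt etas.
have se0 : 0 < Num.sqrt etas by rewrite sqrtr_gt0.
have C0 : 0 < bigC b by rewrite divr_gt0 ?exprn_gt0.
have A0 : 0 < A by rewrite mulr_gt0.
have hA r : A <= r -> 4 * Num.sqrt etas < b * r.
  move=> Ar; apply: (@lt_le_trans _ _ (b * A)); last by rewrite ler_pM2l.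
  rewrite /A mulrA ltr_pM2r//; apply: lt_le_trans (bigC_ge b hb).
  by rewrite -natrX ltr_nat.
have eta_gt0 r : r <= t -> 0 < eta r.
  by move=> rt; rewrite /eta (eta_flowE lambda _ hn hmu0)// mulr_gt0// subr_gt0 rS.
have kslope r : 0 < r -> r <= t -> exists P, [/\
    forall r', 0 <= r' -> kappa r + (r - r') * P <= kappa r',
    y * S * (kappa r / eta r) < P &
    A <= r -> 0 <= kappa r <= T ^+ 2 -> b / 8 * Num.sqrt (kappa r) <= P].
  move=> r0 rt; have [xi pxi] := preedge_exists lambda r hn r0.
  exists (green lambda xi - cgreen lambda x y); split.
  - by move=> r' r'0; exact: (kappa_convex lambda mu hn hmu0 hmu x y y0).
  - by apply: (slope_gt_ratio lambda mu hn hmu0 hmu x y y0) => //; exact: rS.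
  move=> Ar; rewrite /kappa (kappa_flowE lambda mu hn hmu0 hmu x y y0 r xi)//.
  apply: (slope_growth lambda b etas T) => //.
  - by rewrite r0 (le_trans rt).
  - exact: hA.
  - exact: rS.
have ratio_ge0 r : r <= t -> 0 <= kappa r -> 0 <= y * S * (kappa r / eta r).
  move=> rt k0; apply: mulr_ge0; first by rewrite mulr_ge0// ltW.
  by rewrite divr_ge0// ltW// eta_gt0.
have L0 : 0 <= ln n%:R `^ (15 / 2) * n%:R `^ (- (1 / 3)) :> R.
  by rewrite mulr_ge0 ?powR_ge0.
have eb0 r : 0 <= edge_bound n b etas r by rewrite /edge_bound sqr_ge0.
have c_bounds := smallc_bounds b hb.
(* The first claim at a time [s'] independent of [s]: the second claim also needs
   it, at the time [A] until which [edge_bound] is constant. *)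
have phase2 s' : A <= s' <= t -> kappa s' <= T ^+ 2 ->
    edge_bound n b etas t <= kappa t ->
    (t - s') / 2 * (y * S * (kappa t / eta t)) <= kappa s' - edge_bound n b etas s'.
  move=> /andP[As st] ks' ft.
  have s0 : 0 < s' by exact: lt_le_trans As.
  have kt0 : 0 <= kappa t by exact: le_trans ft.
  have [Pt [convt ratt _]] := kslope t t0 (lexx _).
  have Pt0 : 0 < Pt by apply: le_lt_trans ratt; exact: ratio_ge0.
  have kpos r : s' <= r -> r <= t -> kappa t <= kappa r.
    move=> sr rt; apply: le_trans (convt r _); last by rewrite (le_trans (ltW s0)).
    by rewrite lerDl mulr_ge0 ?subr_ge0// ltW.
  have /andP[c0 c6] := c_bounds.
  have growth : Num.sqrt (kappa t) + smallc b / 4 * (t - s') <= Num.sqrt (kappa s').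
    apply: sqrt_growth => //.
    - by apply/andP; split; lra.
    - move=> r' r sr' r'r rt kr0.
      have sr := le_trans sr' r'r.
      have r0 : 0 < r by exact: lt_le_trans sr.
      have [P [conv rat gro]] := kslope r r0 rt.
      have P0 : 0 < P by apply: le_lt_trans rat; exact: ratio_ge0.
      have krT : kappa r <= T ^+ 2.
        apply: le_trans ks'; apply: le_trans (conv s' (ltW s0)).
        by rewrite lerDl mulr_ge0 ?subr_ge0// ltW.
      apply: le_trans (conv r' _); last exact: le_trans (ltW s0) sr'.
      rewrite lerD2l ler_wpM2l ?subr_ge0//.
      apply: le_trans (gro (le_trans As sr) _); last by rewrite kr0.
      by rewrite ler_wpM2r ?sqrtr_ge0//; lra.
    - move=> r /andP[sr rt]; apply: lt_le_trans (convt r _).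
        by rewrite ltr_wpDl// mulr_gt0// subr_gt0.
      exact: le_trans (ltW s0) sr.
  apply: (@le_trans _ _ ((t - s') / 2 * Pt)).
    by rewrite ler_wpM2l ?divr_ge0 ?subr_ge0// ltW.
  have ft' := ft; rewrite /edge_bound in ft'.
  apply: (combine_growth _ _ _ _ _ _ _ _ _ ft' _ _ _ _ growth (convt _ (ltW s0))).
  - by rewrite le_max L0 orbT.
  - by rewrite le_max L0 orbT.
  - exact: le_trans kt0 (kpos s' (lexx _) st).
  - by rewrite divr_ge0.
  - by rewrite subr_ge0.
  have -> : smallc b / 4 / 2 = smallc b / 8 by field.
  by apply: max_affine_le; [rewrite divr_ge0|rewrite As].
split=> [ft hs'|tt ft /andP[s0 stt]].
  by rewrite -mulrA; exact: phase2.
have ttt : tt <= t by rewrite ge_min lexx.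
have ttA : tt <= A by rewrite ge_min lexx orbT.
have tt0 : 0 < tt by rewrite lt_min t0.
have kt0 : 0 <= kappa t by exact: le_trans ft.
have [P [conv rat _]] := kslope tt tt0 ttt.
have ktt : edge_bound n b etas tt <= kappa tt.
  have [tA|At] := leP t A; first by rewrite /tt (min_idPl tA).
  have tE : tt = A by rewrite /tt; apply: min_idPr; exact: ltW.
  have [Pt [convt ratt _]] := kslope t t0 (lexx _).
  have Pt0 : 0 < Pt by apply: le_lt_trans ratt; exact: ratio_ge0.
  have ktt0 : 0 <= kappa tt.
    apply: le_trans (convt tt (ltW tt0)).
    by rewrite addr_ge0// mulr_ge0 ?subr_ge0// ltW.
  have P0 : 0 < P by apply: le_lt_trans rat; exact: ratio_ge0.
  have kttT : kappa tt <= T ^+ 2.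
    apply: le_trans hks; apply: le_trans (conv s s0).
    by rewrite lerDl mulr_ge0 ?subr_ge0// ltW.
  rewrite -subr_ge0; apply: le_trans (phase2 tt _ kttT ft); last first.
    by rewrite tE lexx ltW.
  by rewrite mulr_ge0 ?ratio_ge0// divr_ge0// subr_ge0.
have -> : edge_bound n b etas s = edge_bound n b etas tt.
  rewrite (edge_bound_const _ _ _ tt)// (edge_bound_const _ _ _ s)//.
  exact: le_trans stt ttA.
have := conv s s0.
have : (tt - s) * (y * S * (kappa tt / eta tt)) <= (tt - s) * P.
  by rewrite ler_wpM2l ?subr_ge0// ltW.
by rewrite -mulrA; lra.
Qed.
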